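(* Let $\mathbb F$ be a field, let $n\geq 2$, and let $\mathcal C\subseteq \mathrm{U}(n,\mathbb F)$ be a nonzero $\mathbb F$-linear subspace whose minimum flag-rank distance is $\delta$ (that is, $\delta=\min\{\mathrm{w}_{\mathrm{fr}}(M): M\in\mathcal C,\ M\neq 0\}$). Then $$\operatorname{codim}_{\mathbb F}(\mathcal C)\;=\;\frac{n(n+1)}{2}-\dim_{\mathbb F}(\mathcal C)\;\geq\; \delta-1+\lfloor\sqrt{\delta-1}\rfloor\cdot\left\lfloor\frac{\sqrt{4(\delta-1)+1}-1}{2}\right\rfloor.$$
   Context: $\mathrm{U}(n,\mathbb F)$ denotes the $\mathbb F$-vector space of $n\times n$ upper triangular matrices over $\mathbb F$ (diagonal included), of dimension $n(n+1)/2$. For $M\in\mathrm{U}(n,\mathbb F)$ and $i\in\{1,\dots,n\}$, $M_{[i]}$ denotes the top-rightmost $i\times(n-i+1)$ submatrix of $M$ (rows $1,\dots,i$ and columns $i,\dots,n$). The flag-rank weight is $\mathrm{w}_{\mathrm{fr}}(M)=\sum_{i=1}^n \operatorname{rk}(M_{[i]})$. *)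

(* Defs.v *)
From mathcomp Require Import all_boot all_order all_algebra.
Set Implicit Arguments.
Unset Strict Implicit.
Unset Printing Implicit Defensive.
Import GRing.Theory.
Local Open Scope ring_scope.

(* The space U(n, F), as the span of the matrix units E_ij with i <= j. *)
Definition upper_mx (F : fieldType) (n : nat) : {vspace 'M[F]_n} :=
  (\sum_(i < n) \sum_(j < n | (i <= j)%N) <[delta_mx i j]>)%VS.

(* [is_trig_mx] means lower triangular, hence the transpose. *)
Lemma mem_upper_mx (F : fieldType) (n : nat) (M : 'M[F]_n) :
  (M \in upper_mx F n) = is_trig_mx M^T.
Proof.
apply/idP/is_trig_mxP => [/memv_sumP[f fU ->] i j ltij | tM].
  rewrite mxE summxE big1 // => k _.
  have /memv_sumP[g gU ->] := fU k isT.
  rewrite summxE big1 // => l lekl.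
  have /vlineP[c ->] := gU l lekl.
  rewrite !mxE; case: eqP => [ek|]; last by rewrite mulr0.
  case: eqP => [el|]; last by rewrite mulr0.
  by move: lekl; rewrite -ek -el leqNgt ltij.
rewrite (matrix_sum_delta M); apply: memv_sumr => i _.
rewrite rpred_sum // => j _.
have [leij | ltji] := leqP i j; last first.
  by have := tM j i ltji; rewrite mxE => ->; rewrite scale0r rpred0.
by rewrite rpredZ // memvE (sumv_sup j).
Qed.

(* Indices are 0-based: rows 0, ..., i and columns i, ..., n - 1 of M form the
   block M_[i+1]. *)
Definition top_right_mx (F : fieldType) (n : nat) (i : 'I_n) (M : 'M[F]_n) :
    'M[F]_(i.+1, n - i) :=
  mxsub (widen_ord (ltn_ord i))
        (fun k => cast_ord (subnKC (ltnW (ltn_ord i))) (rshift i k)) M.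

Definition flag_rank_weight (F : fieldType) (n : nat) (M : 'M[F]_n) : nat :=
  (\sum_(i < n) \rank (top_right_mx i M))%N.

Definition is_min_flag_rank_distance (F : fieldType) (n : nat)
    (C : {vspace 'M[F]_n}) (delta : nat) : Prop :=
  (exists M, [/\ M \in C, M != 0 & flag_rank_weight M = delta]) /\
  (forall M, M \in C -> M != 0 -> (delta <= flag_rank_weight M)%N).

(* Main.v *)
(* The codimension of C is at least the dimension of any subspace S of U(n, F)
   on which the weight stays below delta, since then S meets C trivially.
   Matrices supported on the leading triangle U(m, F) have weight at most
   floor((m+1)^2/4), because their i-th block has at most i nonzero rows and
   m-i+1 nonzero columns; allowing also the j bottommost entries of the next
   column costs at most 1 in each of j blocks. Taking m maximal with
   floor((m+1)^2/4) <= delta - 1 and j the remainder, S has dimension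
   m(m+1)/2 + j, which dominates the bound; and m < n since the weight of a
   matrix in U(n, F) is at most floor((n+1)^2/4). *)
Require Import Defs.
From mathcomp Require Import all_boot all_order all_algebra reals.
From mathcomp Require Import zify.
Set Implicit Arguments.
Unset Strict Implicit.
Unset Printing Implicit Defensive.
Import Order.TTheory GRing.Theory Num.Theory.
Local Open Scope ring_scope.

(** The columns in [J] span the column space, and each contributes at most 1 to the rank. *)
Lemma mxrank_leq_nonzero_cols (F : fieldType) (p q : nat) (A : 'M[F]_(p, q))
    (J : pred 'I_q) :
  (forall i j, ~~ J j -> A i j = 0) -> (\rank A <= \sum_(j < q) J j)%N.
Proof.
move=> A0; rewrite -mxrank_tr.
have sub : (A^T <= \sum_(j | J j) <<row j A^T>>)%MS.
  apply/row_subP => j; have [Jj|nJj] := boolP (J j).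
    by rewrite (sumsmx_sup j) // genmxE.
  suff -> : row j A^T = 0 by rewrite sub0mx.
  by apply/rowP => i; rewrite !mxE A0.
apply: leq_trans (mxrankS sub) _.
apply: leq_trans (mxrank_sum_leqif _).1 _.
by rewrite /= big_mkcond leq_sum // => j _; case: (J j); rewrite // genmxE rank_leq_row.
Qed.

Definition support_space (F : fieldType) (n : nat) (A : pred ('I_n * 'I_n)) :
    {vspace 'M[F]_n} :=
  (\sum_(p | A p) <[delta_mx p.1 p.2]>)%VS.

Lemma mem_support_space (F : fieldType) (n : nat) (A : pred ('I_n * 'I_n))
    (M : 'M[F]_n) (i j : 'I_n) :
  M \in support_space F A -> ~~ A (i, j) -> M i j = 0.
Proof.
case/memv_sumP=> f fA -> nA; rewrite summxE big1 // => -[k l] Akl.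
have /vlineP[c ->] := fA _ Akl; rewrite !mxE /=.
case: eqP => [ik|]; last by rewrite mulr0.
case: eqP => [jl|]; last by rewrite mulr0.
by rewrite ik jl Akl in nA.
Qed.

Lemma support_spaceS (F : fieldType) (n : nat) (A B : pred ('I_n * 'I_n)) :
  subpred A B -> (support_space F A <= support_space F B)%VS.
Proof. by move=> AB; apply/subv_sumP => p Ap; rewrite (sumv_sup p) ?AB. Qed.

Lemma dim_support_space (F : fieldType) (n : nat) (A : pred ('I_n * 'I_n)) :
  \dim (support_space F A) = #|A|.
Proof.
pose e (p : 'I_n * 'I_n) : 'M[F]_n := delta_mx p.1 p.2.
have spanE (s : seq ('I_n * 'I_n)) :
    (<<[seq e p | p <- s]>> = \sum_(p <- s) <[e p]>)%VS.
  by rewrite span_def big_map.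
have free_all : free [seq e p | p <- enum predT].
  (* Freeness by counting: the n^2 matrix units span a space of dimension n^2. *)
  apply: (@basis_free _ _ fullv); rewrite basisEdim; apply/andP; split.
    apply/subvP => M _; rewrite spanE big_enum /= (matrix_sum_delta M).
    rewrite pair_big; apply: memv_sumr => p _.
    by rewrite rpredZ // memv_line.
  by rewrite size_map -cardE card_prod card_ord dimvf.
have freeA : free [seq e p | p <- enum A].
  have := perm_free (perm_map e (permEl (perm_filterC A (enum predT)))).
  by rewrite free_all map_cat => /catl_free; rewrite enumT.
have -> : support_space F A = <<[seq e p | p <- enum A]>>%VS.
  by rewrite spanE big_enum.
by rewrite (eqnP freeA) size_map -cardE.
Qed.

(** Column [b] keeps its [c b] lowest entries, counted upward from the diagonal. *)
Definition staircase (n : nat) (c : nat -> nat) : pred ('I_n * 'I_n) :=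
  fun p => (p.1 <= p.2 < p.1 + c p.2)%N.

Lemma sum_interval (n lo hi : nat) :
  (\sum_(b < n) (lo <= b < hi) = minn hi n - lo)%N.
Proof. by elim: n => [|n IHn]; rewrite ?big_ord0 ?big_ord_recr ?IHn /=; lia. Qed.

Lemma card_staircase (n : nat) (c : nat -> nat) :
  (forall b, c b <= b.+1)%N -> #|@staircase n c| = (\sum_(b < n) c b)%N.
Proof.
move=> cle; rewrite -sum1_card big_mkcond /=.
rewrite (eq_bigr (fun p : 'I_n * 'I_n => nat_of_bool (staircase c (p.1, p.2)))).
  rewrite -(pair_bigA _ (fun a b => nat_of_bool (staircase c (a, b)))) /=.
  rewrite exchange_big; apply: eq_bigr => b _ /=.
  transitivity (\sum_(a < n) (b.+1 - c b <= a < b.+1))%N.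
    by apply: eq_bigr => a _; rewrite /staircase /=; have := cle b; lia.
  by rewrite sum_interval; have := cle b; have := ltn_ord b; lia.
by case=> a b _; rewrite -[_ \in _]/(staircase c (a, b)); case: staircase.
Qed.

Lemma upper_mxE (F : fieldType) (n : nat) :
  upper_mx F n = support_space F (staircase (n := n) succn).
Proof.
rewrite /upper_mx /support_space pair_big_dep /=.
by apply: eq_bigl => -[a b]; rewrite /staircase /=; lia.
Qed.

Lemma dim_upper_mx (F : fieldType) (n : nat) :
  (\dim (upper_mx F n) = n * (n + 1) %/ 2)%N.
Proof.
rewrite upper_mxE dim_support_space card_staircase //.
have -> : (n * (n + 1) = 2 * \sum_(b < n) b.+1)%N.
  elim: n => [|n IHn]; first by rewrite big_ord0.
  by rewrite big_ord_recr [RHS]mulnDr -IHn /=; lia.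
by rewrite mulKn.
Qed.

(** The highest supported entry of column [b] lies in row [b + 1 - c b]. The column can thus be
    nonzero in the block of rows up to [i] only if [b < i + c b], and the rank is at most the number
    of such columns. *)
Lemma rank_top_right_mx_staircase (F : fieldType) (n : nat) (c : nat -> nat)
    (M : 'M[F]_n) (i : 'I_n) :
  M \in support_space F (staircase c) ->
  (\rank (top_right_mx i M) <= \sum_(b < n) (i <= b < i + c b))%N.
Proof.
move=> MS; pose J (k : 'I_(n - i)) := (i + k < i + c (i + k))%N.
apply: (@leq_trans (\sum_k J k)%N).
  apply: mxrank_leq_nonzero_cols => a k; rewrite mxE => nJk.
  apply: mem_support_space MS _; rewrite /staircase /=.
  by have := ltn_ord a; move: nJk; rewrite /J; lia.
rewrite -(big_mkord xpredT (fun b => nat_of_bool (i <= b < i + c b)%N)).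
rewrite (big_cat_nat (n := i)) //=; last exact: ltnW.
apply: leq_trans (leq_addl _ _).
rewrite (big_addn 0 n (val i)) big_mkord leq_sum // => k _.
by rewrite /J [(i + k)%N]addnC leq_addl.
Qed.

(* The sum of [min(i+1, m-i)] for [i < m], i.e. floor((m+1)^2/4): the largest
   flag-rank weight in U(m, F). *)
Definition max_weight (m : nat) : nat := (uphalf m * (m./2).+1)%N.

Lemma max_weightS (m : nat) : max_weight m.+1 = (max_weight m + (m./2).+1)%N.
Proof.
have := uphalf_half m; rewrite /max_weight /=.
by case: (odd m) => /= ->; rewrite ?add1n ?add0n; nia.
Qed.

Lemma leq_max_weight : {homo max_weight : m p / (m <= p)%N}.
Proof.
apply: homo_leq => // [a b c|m]; first exact: leq_trans.
by rewrite max_weightS leq_addr.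
Qed.

Lemma max_weight_interval (d : nat) :
  exists m, (max_weight m <= d < max_weight m.+1)%N.
Proof.
elim: d => [|d [m /andP[le_d lt_d]]]; first by exists 0.
have [lt_dS|ge_dS] := ltnP d.+1 (max_weight m.+1).
  by exists m; rewrite lt_dS leqW.
by exists m.+1; rewrite ge_dS [max_weight m.+2]max_weightS /=; lia.
Qed.

Lemma sum_min_max_weight (n m : nat) :
  (\sum_(i < n) minn i.+1 (m - i) <= max_weight m)%N.
Proof.
have sumE : forall m, (\sum_(i < m) minn i.+1 (m - i) = max_weight m)%N.
  move=> {n}{}m; elim/ltn_ind: m => -[|[|m]] IH.
  - by rewrite big_ord0.
  - by rewrite big_ord1.
  (* The first and last terms for [m.+2] equal 1, and each inner term exceeds the corresponding term
     for [m] by 1. *)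
  rewrite big_ord_recl big_ord_recr /= /bump.
  rewrite (eq_bigr (fun i : 'I_m => minn i.+1 (m - i) + 1))%N; last first.
    by move=> i _; have := ltn_ord i; lia.
  rewrite big_split /= IH // sum_nat_const card_ord /max_weight /=.
  by have := odd_double_half m; have := uphalf_half m; nia.
(* For [n <= m] the sum is a truncation of the full one; for [m < n] the additional terms vanish. *)
rewrite -sumE; have [le_nm|lt_mn] := leqP n m.
  by rewrite (big_ord_widen m (fun i => minn i.+1 (m - i))%N le_nm)
             [leqRHS](bigID (fun i : 'I_m => i < n)%N) leq_addr.
rewrite (big_ord_widen n (fun i => minn i.+1 (m - i))%N (ltnW lt_mn)).
rewrite (bigID (fun i : 'I_n => i < m)%N) /= [X in (_ + X)%N]big1 ?addn0 //.
by move=> i; lia.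
Qed.

Lemma flag_rank_weight_upper (F : fieldType) (n : nat) (M : 'M[F]_n) :
  (flag_rank_weight M <= max_weight n)%N.
Proof.
apply: leq_trans (sum_min_max_weight n n); apply: leq_sum => i _.
by rewrite leq_min rank_leq_row rank_leq_col.
Qed.

(* Column heights of the triangle of size [m] with the [j] bottommost entries
   of the next column adjoined. *)
Definition anticode_height (m j b : nat) : nat :=
  if (b < m)%N then b.+1 else if b == m then j else 0%N.

Lemma card_anticode (n m j : nat) : (m < n)%N -> (j <= m.+1)%N ->
  (2 * #|staircase (n := n) (anticode_height m j)| = m * m.+1 + 2 * j)%N.
Proof.
move=> lt_mn lejm; rewrite card_staircase; last first.
  by move=> b; rewrite /anticode_height; case: ltnP => //; case: eqP; lia.
have sumE : (2 * \sum_(b < n) anticode_height m j b =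
    if n <= m then n * n.+1 else m * m.+1 + 2 * j)%N.
  elim: n {lt_mn} => [|n IHn]; first by rewrite big_ord0.
  rewrite big_ord_recr mulnDr IHn /= /anticode_height.
  case: (ltngtP n m) => [lt_nm|lt_mn|->]; lia.
by rewrite sumE leqNgt lt_mn.
Qed.

Lemma flag_rank_weight_anticode (F : fieldType) (n m j : nat) (M : 'M[F]_n) :
  M \in support_space F (staircase (anticode_height m j)) ->
  (flag_rank_weight M <= max_weight m + j)%N.
Proof.
(* [last_col] selects the blocks that column [m] can reach: [i <= m < i + j]. *)
move=> MS; pose last_col i := (m.+1 - j <= i < m.+1)%N.
apply: (@leq_trans (\sum_(i < n) (minn i.+1 (m - i) + last_col i))%N); last first.
  rewrite big_split leq_add ?sum_min_max_weight // sum_interval; lia.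
apply: leq_sum => i _; have rk_row := rank_leq_row (top_right_mx i M).
have := rank_top_right_mx_staircase i MS.
have -> : (\sum_(b < n) (i <= b < i + anticode_height m j b) =
  \sum_(b < n) (i <= b < m) + last_col i * \sum_(b < n) (m <= b < m.+1))%N.
  rewrite big_distrr -big_split; apply: eq_bigr => b _ /=.
  rewrite /anticode_height /last_col.
  by case: (ltngtP b m) => ?; lia.
rewrite !sum_interval; case: (last_col i); lia.
Qed.

(** Everything is doubled so that m(m+1)/2 involves no division. *)
Lemma codim_anticode (F : fieldType) (n : nat) (C : {vspace 'M[F]_n})
    (delta m j : nat) :
  (C <= upper_mx F n)%VS ->
  (forall M, M \in C -> M != 0 -> (delta <= flag_rank_weight M)%N) ->
  (m < n)%N -> (j <= m.+1)%N -> (max_weight m + j < delta)%N ->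
  (2 * \dim C + m * m.+1 + 2 * j <= 2 * \dim (upper_mx F n))%N.
Proof.
move=> CU dC lt_mn lejm ltd; rewrite -addnA -(card_anticode lt_mn lejm).
rewrite -(dim_support_space F) -mulnDr leq_mul2l /=.
set S := support_space F _.
have CS0 : (C :&: S = 0)%VS.
  apply/eqP; rewrite -subv0; apply/subvP => M; rewrite memv_cap memv0.
  case/andP=> MC MS; apply: contraTT ltd => M0; rewrite -leqNgt.
  exact: leq_trans (dC M MC M0) (flag_rank_weight_anticode MS).
rewrite -dimv_disjoint_sum // dimvS // subv_add CU upper_mxE support_spaceS //.
by case=> a b; rewrite /staircase /anticode_height /=; case: ltnP => //; lia.
Qed.

Lemma floor_le_nat (R : realType) (x : R) (k : nat) :
  x < k.+1%:R -> Num.floor x <= k%:Z.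
Proof. by move=> ltx; rewrite -ltzD1 addrC -intS floor_lt_int. Qed.

Lemma sqrtr_lt_nat (R : realType) (x : R) (k : nat) :
  (0 < k)%N -> (Num.sqrt x < k%:R) = (x < (k ^ 2)%:R).
Proof.
have k_ge0 : 0 <= k%:R :> R by [].
move=> k_gt0; rewrite -[k%:R in LHS]ger0_norm // -sqrtr_sqr -natrX.
by rewrite ltr_sqrt // ltr0n expn_gt0 k_gt0.
Qed.

Theorem theorem3p2 (R : realType) (F : fieldType) (n : nat)
    (C : {vspace 'M[F]_n}) (delta : nat) :
  (2 <= n)%N ->
  (C <= upper_mx F n)%VS ->
  C != 0%VS ->
  is_min_flag_rank_distance C delta ->
  let codim : int := (\dim (upper_mx F n))%:Z - (\dim C)%:Z in
  let d : R := delta%:R - 1 in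
  codim = (n * (n + 1) %/ 2)%N%:Z - (\dim C)%:Z /\
  codim >= delta%:Z - 1 +
    Num.floor (Num.sqrt d) * Num.floor ((Num.sqrt (4 * d + 1) - 1) / 2).
Proof.
move=> n2 CU C0 [[M [MC M0 wM]] dC] codim d.
split; first by rewrite /codim dim_upper_mx.
have dimCU := dimvS CU; rewrite {}/codim {}/d.
case: delta wM dC => [|d] wM dC.
  (* For [delta = 0] the first radicand is negative, so its [Num.sqrt] is 0 by convention and the
     bound is just -1. *)
  rewrite [Num.sqrt (0%:R - 1)]ler0_sqrtr ?sub0r ?lerN10 // floor0 mul0r.
  by lia.
have -> : d.+1%:R - 1 = d%:R :> R by rewrite -natr1 addrK.
have [m /andP[lem ltm]] := max_weight_interval d.
have lt_mn : (m < n)%N.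
  rewrite ltnNge; apply/negP => /leq_max_weight le_nm.
  by have := flag_rank_weight_upper M; rewrite wM; lia.
have j_small : (d - max_weight m <= m.+1)%N.
  by move: ltm; rewrite max_weightS; lia.
have := codim_anticode CU dC lt_mn j_small.
rewrite subnKC // => /(_ (leqnn _)) bound.
set s := Num.floor _; set t := Num.floor _.
have s_ge0 : 0 <= s by rewrite floor_ge0 sqrtr_ge0.
have sqrt_ge1 : 1 <= Num.sqrt (4 * d%:R + 1) :> R.
  by rewrite -[leLHS]sqrtr1 ler_sqrt ?lerDr ?mulr_ge0 ?addr_ge0 ?mulr_ge0.
have t_ge0 : 0 <= t by rewrite floor_ge0 divr_ge0 // subr_ge0.
have sP (k : nat) : (d < k.+1 ^ 2)%N -> s <= k%:Z.
  by move=> dk; apply: floor_le_nat; rewrite sqrtr_lt_nat // ltr_nat.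
(* The threshold comes from (2k+3)^2 = 4(k+1)(k+2) + 1. *)
have tP (k : nat) : (d < k.+1 * k.+2)%N -> t <= k%:Z.
  move=> dk; apply: floor_le_nat; rewrite ltr_pdivrMr // ltrBlDr.
  rewrite -!natrM !natr1 sqrtr_lt_nat // ltr_nat; lia.
have st_le (k l : nat) : (d < k.+1 * k.+1)%N -> (d < l.+1 * l.+2)%N ->
    s * t <= (k * l)%N.
  by rewrite mulnn => /sP sk /tP tl; rewrite PoszM ler_pM.
(* Write m = 2k or 2k+1. If m is odd, (k+1)^2 <= d < (k+1)(k+2), the floors are at most k+1 and k,
   and m(m+1)/2 + j = d + k(k+1). If m is even, k(k+1) <= d < (k+1)^2, both floors are at most k,
   and m(m+1)/2 + j = d + k^2. *)
move: bound lem ltm; rewrite -{1 2}(odd_double_half m).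
rewrite max_weightS /max_weight uphalf_half; set k := m./2.
case: (odd m); rewrite ?add1n ?add0n => bound lem ltm.
  have := st_le k.+1 k; move: (s * t) => st; nia.
have := st_le k k; move: (s * t) => st; nia.
Qed.
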